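(* Let $S$ be a set with $2 \leq |S| < \infty$, let $(X_s)_{s \in S}$ be a family of nonempty finitely generated racks, and let $X = \ast_{s \in S} X_s$ be their free product. Then the second bounded rack cohomology $H_{\mathrm{b}}^2(X, \mathbb{R})$ is infinite-dimensional as a real vector space.
   Context: A rack is a set $X$ with a binary operation $\triangleleft \colon X \times X \to X$ such that $(x \triangleleft y) \triangleleft z = (x \triangleleft z) \triangleleft (y \triangleleft z)$ for all $x,y,z \in X$, and for every $y \in X$ the map $\psi_y \colon X \to X$, $\psi_y(x) = x \triangleleft y$, is bijective. Write $x \triangleleft^n y = \psi_y^n(x)$ for $n \in \mathbb{Z}$. A rack $X$ is finitely generated if there is a finite subset $A \subset X$ such that every $x \in X$ can be written as $x = (\cdots((a_0 \triangleleft^{\varepsilon_1} a_1) \triangleleft^{\varepsilon_2} a_2) \cdots) \triangleleft^{\varepsilon_n} a_n$ with $n \geq 0$, $a_0, \dots, a_n \in A$ and $\varepsilon_i \in \{\pm 1\}$. The adjoint group of a rack $X$ is $\mathrm{Ad}(X) = \langle e_x \ (x \in X) \mid e_x e_y = e_y e_{x \triangleleft y} \ (x, y \in X) \rangle$. It acts on $X$ from the right by $x \cdot e_y = x \triangleleft y$. Free product of racks: given racks $X_s$ ($s \in S$), the free product $\ast_{s \in S} X_s$ is the set of pairs $(x, g)$ with $x \in X_t$ for some $t \in S$ and $g \in \ast_{s \in S} \mathrm{Ad}(X_s)$ (free product of groups), modulo the equivalence relation generated by $(x, g w) \sim (x \cdot g, w)$ for $t \in S$, $x \in X_t$, $g \in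 \mathrm{Ad}(X_t)$, $w \in \ast_{s \in S} \mathrm{Ad}(X_s)$. The operation is $(x, g) \triangleleft (y, h) = (x, g h^{-1} e_y h)$, which is well defined. Bounded rack cohomology: for $n \geq 0$ let $C^n_{\mathrm{b}}(X; \mathbb{R})$ be the real vector space of bounded functions $X^n \to \mathbb{R}$ ($X^0$ a one-point set). For $n \ge 1$ let $\delta^n \colon C^n_{\mathrm{b}} \to C^{n+1}_{\mathrm{b}}$ be $$\delta^n f(x_1, \dots, x_{n+1}) = \sum_{i=1}^{n+1} (-1)^i \left[ f(x_1, \dots, x_{i-1}, x_{i+1}, \dots, x_{n+1}) - f(x_1 \triangleleft x_i, \dots, x_{i-1} \triangleleft x_i, x_{i+1}, \dots, x_{n+1}) \right],$$ and $\delta^n = 0$ for $n \leq 0$. Then $H^n_{\mathrm{b}}(X, \mathbb{R}) = \ker \delta^n / \operatorname{im} \delta^{n-1}$ for this complex of bounded cochains. In particular $\delta^1 f(x,y) = f(x) - f(x \triangleleft y)$. *)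

(* Defs.v *)
From HB Require Import structures.
From mathcomp Require Import all_boot all_order all_algebra.
From mathcomp Require Import boolp functions reals.
From mathcomp Require Import zify ring.
From Stdlib Require Import Relation_Operators.

Set Implicit Arguments.
Unset Strict Implicit.
Unset Printing Implicit Defensive.

Import Order.TTheory GRing.Theory Num.Theory.

(* The choiceType structure is no restriction: by gen_choiceMixin every type
   has one. *)
HB.mixin Record isRack X of Choice X := {
  rack_op : X -> X -> X;
  rack_opD : forall x y z : X,
    rack_op (rack_op x y) z = rack_op (rack_op x z) (rack_op y z);
  rack_bij : forall y : X, bijective (fun x => rack_op x y)
}.

#[short(type="rackType")]
HB.structure Definition Rack := {X of isRack X & Choice X}.

Declare Scope rack_scope.
Delimit Scope rack_scope with rack.
Notation "x ◁ y" := (rack_op x y) (at level 40, left associativity) : rack_scope.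
Local Open Scope rack_scope.

Section RackTheory.
Variable X : rackType.
Implicit Types x y : X.

Lemma rack_opV_subproof x y : exists z, z ◁ y == x.
Proof. by have [f _ fK] := rack_bij y; exists (f x); rewrite fK. Qed.

(* x ◁^(-1) y *)
Definition rack_opV x y : X := xchoose (rack_opV_subproof x y).

Lemma rack_opVK x y : rack_opV x y ◁ y = x.
Proof. exact/eqP/(xchooseP (rack_opV_subproof x y)). Qed.

Lemma rack_opK x y : rack_opV (x ◁ y) y = x.
Proof. exact: (bij_inj (rack_bij y)) (rack_opVK _ _). Qed.

(* In a signed letter (x, b) the boolean b is true for the exponent -1, as in
   (-1) ^+ b. *)
Definition rack_opS x (a : X * bool) : X :=
  if a.2 then rack_opV x a.1 else x ◁ a.1.

Definition rack_word x (w : seq (X * bool)) : X := foldl rack_opS x w.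

Definition rack_fg : Prop :=
  exists A : seq X, forall x : X, exists a0 (w : seq (X * bool)),
    [/\ a0 \in A, all (fun a => a.1 \in A) w & x = rack_word a0 w].

End RackTheory.

Arguments rack_fg : clear implicits.

Section Presentation.
Variables (T : choiceType) (rel : seq (T * bool) -> seq (T * bool) -> Prop).
Local Notation word := (seq (T * bool)).
Implicit Types u v w : word.

Inductive pres_eq : word -> word -> Prop :=
| pres_rel u v : rel u v -> pres_eq u v
| pres_inv a b : pres_eq [:: (a, b); (a, ~~ b)] [::]
| pres_cat u u' v v' : pres_eq u u' -> pres_eq v v' ->
    pres_eq (u ++ v) (u' ++ v')
| pres_refl u : pres_eq u u
| pres_sym u v : pres_eq u v -> pres_eq v u
| pres_trans u v w : pres_eq u v -> pres_eq v w -> pres_eq u w.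

Definition pres_eqb u v : bool := `[< pres_eq u v >].

Lemma pres_eqb_equiv : equiv_class_of pres_eqb.
Proof.
split=> [u | u v | v u w]; first exact/asboolP/pres_refl.
- by apply/asboolP/asboolP; exact: pres_sym.
- move=> /asboolP uv /asboolP vw; apply/asboolP; exact: pres_trans uv vw.
Qed.

Canonical pres_equiv := EquivRelPack pres_eqb_equiv.

Local Open Scope quotient_scope.

Definition pres_group := {eq_quot pres_eqb}.
HB.instance Definition _ : EqQuotient word pres_eqb pres_group :=
  EqQuotient.on pres_group.
HB.instance Definition _ := Choice.on pres_group.

Definition pres_class u : pres_group := \pi_pres_group u.

Lemma pres_classP u v : pres_class u = pres_class v <-> pres_eq u v.
Proof.
split=> [/eqmodP /asboolP // | uv]; exact/eqmodP/asboolP.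
Qed.

Lemma pres_class_repr g : pres_class (repr g) = g.
Proof. exact: reprK. Qed.

Definition word_inv u : word := rev [seq (a.1, ~~ a.2) | a <- u].

Lemma word_invP u : pres_eq (u ++ word_inv u) [::].
Proof.
elim: u => [|[a b] u IH]; first exact: pres_refl.
rewrite /word_inv /= rev_cons -cats1 catA -/(word_inv u).
apply: (pres_trans (v := [:: (a, b)] ++ [:: (a, ~~ b)])).
  rewrite -[_ :: _]/([:: (a, b)] ++ (u ++ word_inv u) ++ [:: (a, ~~ b)]).
  apply: pres_cat; first exact: pres_refl.
  rewrite -{2}[[:: (a, ~~ b)]]cat0s; apply: pres_cat => //; exact: pres_refl.
exact: pres_inv.
Qed.

Lemma word_invK : involutive word_inv.
Proof.
move=> u; rewrite /word_inv map_rev revK -map_comp -[RHS]map_id.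
by apply: eq_map => -[a b] /=; rewrite negbK.
Qed.

Lemma word_invPV u : pres_eq (word_inv u ++ u) [::].
Proof. by rewrite -{2}(word_invK u); exact: word_invP. Qed.

Lemma word_inv_eq u v : pres_eq u v -> pres_eq (word_inv u) (word_inv v).
Proof.
move=> uv; apply: (pres_trans (v := word_inv u ++ (v ++ word_inv v))).
  rewrite -{1}[word_inv u]cats0; apply: pres_cat; first exact: pres_refl.
  exact/pres_sym/word_invP.
rewrite catA -{2}[word_inv v]cat0s; apply: pres_cat; last exact: pres_refl.
apply: pres_trans (word_invPV u); apply: pres_cat; first exact: pres_refl.
exact: pres_sym.
Qed.

Definition pres_mul (g h : pres_group) : pres_group :=
  pres_class (repr g ++ repr h).
Definition pres_one : pres_group := pres_class [::].
Definition pres_Vg (g : pres_group) : pres_group :=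
  pres_class (word_inv (repr g)).

Lemma repr_pres u : pres_eq (repr (pres_class u)) u.
Proof. by apply/pres_classP; rewrite pres_class_repr. Qed.

Lemma pres_mulE u v :
  pres_mul (pres_class u) (pres_class v) = pres_class (u ++ v).
Proof. apply/pres_classP; apply: pres_cat; exact: repr_pres. Qed.

Lemma pres_VgE u : pres_Vg (pres_class u) = pres_class (word_inv u).
Proof. apply/pres_classP/word_inv_eq/repr_pres. Qed.

Lemma pres_mulA : associative pres_mul.
Proof.
move=> g h k; rewrite -(pres_class_repr g) -(pres_class_repr h).
by rewrite -(pres_class_repr k) !pres_mulE catA.
Qed.

Lemma pres_mul1 : left_id pres_one pres_mul.
Proof. by move=> g; rewrite -(pres_class_repr g) pres_mulE. Qed.

Lemma pres_mulr1 : right_id pres_one pres_mul.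
Proof. by move=> g; rewrite -(pres_class_repr g) pres_mulE cats0. Qed.

Lemma pres_mulV : left_inverse pres_one pres_Vg pres_mul.
Proof.
move=> g; rewrite -(pres_class_repr g) pres_VgE pres_mulE.
exact/pres_classP/word_invPV.
Qed.

Lemma pres_mulrV : right_inverse pres_one pres_Vg pres_mul.
Proof.
move=> g; rewrite -(pres_class_repr g) pres_VgE pres_mulE.
exact/pres_classP/word_invP.
Qed.

HB.instance Definition _ := isGroup.Build pres_group
  pres_mulA pres_mul1 pres_mulr1 pres_mulV pres_mulrV.

Definition pres_gen (a : T) : pres_group := pres_class [:: (a, false)].

Lemma pres_class_cat u v : pres_class (u ++ v) = (pres_class u * pres_class v)%g.
Proof. by rewrite -pres_mulE. Qed.

Lemma pres_class_inv u : pres_class (word_inv u) = ((pres_class u)^-1)%g.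
Proof. by rewrite -pres_VgE. Qed.

End Presentation.

Section Adjoint.
Variable X : rackType.

Inductive ad_rel : seq (X * bool) -> seq (X * bool) -> Prop :=
  AdRel x y : ad_rel [:: (x, false); (y, false)] [:: (y, false); (x ◁ y, false)].

Definition Ad : groupType := pres_group ad_rel.

Definition ad_gen (x : X) : Ad := pres_gen ad_rel x.

Lemma ad_genP (x y : X) : (ad_gen x * ad_gen y = ad_gen y * ad_gen (x ◁ y))%g.
Proof. rewrite -!pres_class_cat; exact/pres_classP/pres_rel/AdRel. Qed.

Definition ad_act (x : X) (g : Ad) : X := rack_word x (repr g).

Lemma rack_word_eq (x : X) u v :
  pres_eq ad_rel u v -> rack_word x u = rack_word x v.
Proof.
move=> uv; elim: uv x => {u v} //.
- by move=> _ _ [y z] x; rewrite /rack_word /= /rack_opS /= rack_opD.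
- move=> y [] x; rewrite /rack_word /= /rack_opS /=.
    exact: rack_opVK.
  exact: rack_opK.
- move=> u u' v v' _ IHu _ IHv x; rewrite /rack_word !foldl_cat.
  rewrite -/(rack_word x u) -/(rack_word x u') IHu; exact: IHv.
- by move=> u v w _ IHu _ IHv x; rewrite IHu.
Qed.

Lemma ad_act_class x u : ad_act x (pres_class ad_rel u) = rack_word x u.
Proof. exact/rack_word_eq/repr_pres. Qed.

Lemma ad_act_gen x y : ad_act x (ad_gen y) = x ◁ y.
Proof. by rewrite ad_act_class. Qed.

Lemma ad_actM x g h : ad_act x (g * h)%g = ad_act (ad_act x g) h.
Proof.
rewrite -(pres_class_repr g) -(pres_class_repr h) -pres_class_cat.
by rewrite !ad_act_class /rack_word foldl_cat.
Qed.

Lemma ad_act1 x : ad_act x 1%g = x.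
Proof. exact: (ad_act_class x [::]). Qed.

Lemma ad_gen_act x g : ad_gen (ad_act x g) = (g^-1 * ad_gen x * g)%g.
Proof.
rewrite -(pres_class_repr g) ad_act_class.
elim: (repr g) x => [|[y b] u IH] x.
  by rewrite -[pres_class _ [::]]/(1%g : Ad) /= invg1 mul1g mulg1.
rewrite /= IH -cat1s pres_class_cat invgM.
suff -> : ad_gen (rack_opS x (y, b)) =
    ((pres_class ad_rel [:: (y, b)])^-1 * ad_gen x
       * pres_class ad_rel [:: (y, b)])%g by rewrite !mulgA.
rewrite /rack_opS; case: b => /=.
  have -> : pres_class ad_rel [:: (y, true)] = (ad_gen y)^-1%g.
    by rewrite -pres_class_inv.
  rewrite invgK -{2}(rack_opVK x y).
  by rewrite -mulgA; rewrite mulgA -ad_genP mulgK.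
by rewrite -/(ad_gen y) -mulgA ad_genP mulKg.
Qed.

End Adjoint.

Section FreeProductGroup.
Variables (S : choiceType) (G : S -> groupType).

(* The relations (s, g)(s, h) = (s, gh) between the letters (s, g), g in G s,
   are the multiplication tables of the factors. *)
Inductive fprod_rel :
    seq ({s : S & G s} * bool) -> seq ({s : S & G s} * bool) -> Prop :=
  FProdRel s (g h : G s) : fprod_rel
    [:: (Tagged G g, false); (Tagged G h, false)]
    [:: (Tagged G (g * h)%g, false)].

Definition free_prod : groupType := pres_group fprod_rel.

Definition free_prod_in s (g : G s) : free_prod :=
  pres_gen fprod_rel (Tagged G g).

Lemma free_prod_inM s (g h : G s) :
  (free_prod_in (g * h) = free_prod_in g * free_prod_in h)%g.
Proof.
rewrite -pres_class_cat; exact/esym/pres_classP/pres_rel/FProdRel.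
Qed.

Lemma free_prod_in1 s : free_prod_in (1 : G s)%g = 1%g.
Proof. by apply: (mulgI (free_prod_in (1 : G s)%g)); rewrite -free_prod_inM !mulg1. Qed.

Lemma free_prod_inV s (g : G s) : free_prod_in g^-1%g = (free_prod_in g)^-1%g.
Proof. by apply/(mulgI (free_prod_in g)); rewrite -free_prod_inM !mulgV free_prod_in1. Qed.

End FreeProductGroup.

Section FreeProductRack.
Variables (S : choiceType) (X : S -> rackType).

Local Notation FAd := (free_prod (fun s => Ad (X s))).
Local Notation ad_in t := (@free_prod_in S (fun s => Ad (X s)) t).
Local Notation pre_rack := ({t : S & X t} * FAd)%type.

Inductive frack_step : pre_rack -> pre_rack -> Prop :=
  FRackStep t (x : X t) (g : Ad (X t)) (w : FAd) :
    frack_step (Tagged X x, ad_in t g * w)%g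
               (Tagged X (ad_act x g), w).

Definition frack_eq : pre_rack -> pre_rack -> Prop :=
  clos_refl_sym_trans pre_rack frack_step.

Definition frack_eqb (p q : pre_rack) : bool := `[< frack_eq p q >].

Lemma frack_eqb_equiv : equiv_class_of frack_eqb.
Proof.
split=> [p | p q | q p r]; first exact/asboolP/rst_refl.
- by apply/asboolP/asboolP; exact: rst_sym.
- move=> /asboolP pq /asboolP qr; apply/asboolP; exact: rst_trans pq qr.
Qed.

Canonical frack_equiv := EquivRelPack frack_eqb_equiv.

Local Open Scope quotient_scope.

Definition frack_type := {eq_quot frack_eqb}.
HB.instance Definition _ : EqQuotient pre_rack frack_eqb frack_type :=
  EqQuotient.on frack_type.
HB.instance Definition _ := Choice.on frack_type.

Definition frack_class (p : pre_rack) : frack_type := \pi_frack_type p.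

Lemma frack_classP p q : frack_class p = frack_class q <-> frack_eq p q.
Proof. split=> [/eqmodP /asboolP // | pq]; exact/eqmodP/asboolP. Qed.

Lemma frack_class_repr p : frack_class (repr p) = p.
Proof. exact: reprK. Qed.

Definition fad_gen (y : {t : S & X t}) : FAd := ad_in (tag y) (ad_gen (tagged y)).

Definition pre_op (p q : pre_rack) : pre_rack :=
  (p.1, p.2 * (q.2^-1 * fad_gen q.1 * q.2))%g.

Lemma pre_op_eq p p' q q' :
  frack_eq p p' -> frack_eq q q' -> frack_eq (pre_op p q) (pre_op p' q').
Proof.
move=> pp' qq'; have -> : pre_op p' q' = pre_op p' q.
  congr (_, (_ * _)%g); elim: qq' => //= [_ _ [t x g w] /= | r s t _ IH1 _ IH2].
  - rewrite /fad_gen /= ad_gen_act !free_prod_inM free_prod_inV.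
    by rewrite invgM !mulgA.
  - by rewrite IH2.
elim: pp' => [_ _ [t x g w] | r | r s _ | r s t _ IH1 _].
- by rewrite /pre_op /= -(mulgA (ad_in t g)); exact/rst_step/FRackStep.
- exact: rst_refl.
- exact: rst_sym.
- exact: rst_trans IH1.
Qed.

Definition free_rack_op (p q : frack_type) : frack_type :=
  frack_class (pre_op (repr p) (repr q)).

Lemma free_rack_opE (p q : pre_rack) :
  free_rack_op (frack_class p) (frack_class q) = frack_class (pre_op p q).
Proof.
apply/frack_classP; apply: pre_op_eq; apply/frack_classP; exact: frack_class_repr.
Qed.

Lemma free_rack_opD p q r :
  free_rack_op (free_rack_op p q) r
  = free_rack_op (free_rack_op p r) (free_rack_op q r).
Proof.
rewrite -(frack_class_repr p) -(frack_class_repr q) -(frack_class_repr r).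
rewrite !free_rack_opE; congr (frack_class (_, _)) => /=.
set k := (_ * (repr r).2)%g.
by rewrite !invgM !mulgA !mulgK.
Qed.

Lemma free_rack_bij q : bijective (fun p => free_rack_op p q).
Proof.
pose c := ((repr q).2^-1 * fad_gen (repr q).1 * (repr q).2)%g.
have opE p : free_rack_op (frack_class p) q = frack_class (p.1, p.2 * c)%g.
  by rewrite -{1}(frack_class_repr q) free_rack_opE.
have eqM (p p' : pre_rack) h : frack_eq p p' -> frack_eq (p.1, p.2 * h)%g (p'.1, p'.2 * h)%g.
  elim=> [_ _ [t x g w] | r | r s _ | r s t _ IH1 _].
  - by rewrite /= -mulgA; exact/rst_step/FRackStep.
  - exact: rst_refl.
  - exact: rst_sym.
  - exact: rst_trans IH1.
exists (fun p => frack_class ((repr p).1, (repr p).2 * c^-1)%g) => p.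
- rewrite -(frack_class_repr p) opE.
  set p0 := repr p; set p1 := (p0.1, _).
  have /(eqM _ _ c^-1%g)/frack_classP -> :
      frack_eq (repr (frack_class p1)) p1.
    by apply/frack_classP; rewrite frack_class_repr.
  by rewrite /= mulgK -surjective_pairing.
- by rewrite opE /= mulgVK -surjective_pairing frack_class_repr.
Qed.

HB.instance Definition _ := isRack.Build frack_type free_rack_opD free_rack_bij.

Definition free_rack_prod : rackType := frack_type.

Lemma frack_class_op p q :
  frack_class p ◁ frack_class q = frack_class (pre_op p q).
Proof. exact: free_rack_opE. Qed.

End FreeProductRack.

Local Open Scope ring_scope.

Definition fin_dim (K : fieldType) (V : lmodType K) : Prop :=
  exists (n : nat) (v : 'I_n -> V),
    forall x : V, exists c : 'I_n -> K, x = \sum_i c i *: v i.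

Section QuotientModule.
Variables (K : pzRingType) (V : lmodType K).

Record submodule := Submodule {
  submodule_pred :> {pred V};
  submoduleP : submod_closed submodule_pred
}.

Variable W : submodule.
Local Open Scope quotient_scope.

Definition quot_eqb (x y : V) : bool := x - y \in (W : {pred V}).

Lemma submoduleB x y :
  x \in (W : {pred V}) -> y \in (W : {pred V}) -> x - y \in (W : {pred V}).
Proof. exact: (GRing.submod_closedB (submoduleP W)).2. Qed.

Lemma submodule0 : 0 \in (W : {pred V}).
Proof. exact: (submoduleP W).1. Qed.

Lemma submoduleD x y :
  x \in (W : {pred V}) -> y \in (W : {pred V}) -> x + y \in (W : {pred V}).
Proof. by move=> Wx Wy; rewrite -[x]scale1r (submoduleP W).2. Qed.

Lemma submoduleZ a x : x \in (W : {pred V}) -> a *: x \in (W : {pred V}).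
Proof.
by move=> Wx; rewrite -[a *: x]addr0 (submoduleP W).2 // submodule0.
Qed.

Lemma quot_eqb_equiv : equiv_class_of quot_eqb.
Proof.
split=> [x | x y | y x z]; rewrite /quot_eqb.
- by rewrite subrr submodule0.
- by apply/idP/idP => Wxy; rewrite -opprB -sub0r submoduleB ?submodule0.
- by move=> Wxy Wyz; rewrite -[x](subrK y) -addrA submoduleD.
Qed.

Canonical quot_equiv := EquivRelPack quot_eqb_equiv.
Canonical quot_encModRel := defaultEncModRel quot_eqb.

Definition quot_mod := {eq_quot quot_eqb}.
HB.instance Definition _ : EqQuotient V quot_eqb quot_mod :=
  EqQuotient.on quot_mod.
HB.instance Definition _ := Choice.on quot_mod.

Definition quot_class (x : V) : quot_mod := \pi_quot_mod x.

Lemma quot_classP x y : quot_class x = quot_class y <-> x - y \in (W : {pred V}).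
Proof. by split=> [/eqmodP | xy]; last exact/eqmodP. Qed.

Lemma quot_class_repr p : quot_class (repr p) = p.
Proof. exact: reprK. Qed.

Definition quot_add (p q : quot_mod) : quot_mod := quot_class (repr p + repr q).
Definition quot_opp (p : quot_mod) : quot_mod := quot_class (- repr p).
Definition quot_scale (a : K) (p : quot_mod) : quot_mod :=
  quot_class (a *: repr p).

Lemma repr_quot x : repr (quot_class x) - x \in (W : {pred V}).
Proof. by apply/quot_classP; rewrite quot_class_repr. Qed.

Lemma quot_addE x y : quot_add (quot_class x) (quot_class y) = quot_class (x + y).
Proof.
by apply/quot_classP; rewrite opprD addrACA submoduleD ?repr_quot.
Qed.

Lemma quot_oppE x : quot_opp (quot_class x) = quot_class (- x).
Proof.
apply/quot_classP; rewrite -opprD -sub0r submoduleB ?submodule0 //.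
exact: repr_quot.
Qed.

Lemma quot_scaleE a x : quot_scale a (quot_class x) = quot_class (a *: x).
Proof. apply/quot_classP; rewrite -scalerBr submoduleZ //; exact: repr_quot. Qed.

Lemma quot_ind (P : quot_mod -> Prop) : (forall x, P (quot_class x)) -> forall p, P p.
Proof. by move=> Pc p; rewrite -(quot_class_repr p). Qed.

Lemma quot_addA : associative quot_add.
Proof.
elim/quot_ind=> x; elim/quot_ind=> y; elim/quot_ind=> z.
by rewrite !quot_addE addrA.
Qed.

Lemma quot_addC : commutative quot_add.
Proof. by elim/quot_ind=> x; elim/quot_ind=> y; rewrite !quot_addE addrC. Qed.

Lemma quot_add0 : left_id (quot_class 0) quot_add.
Proof. by elim/quot_ind=> x; rewrite quot_addE add0r. Qed.

Lemma quot_addN : left_inverse (quot_class 0) quot_opp quot_add.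
Proof. by elim/quot_ind=> x; rewrite quot_oppE quot_addE addNr. Qed.

HB.instance Definition _ := GRing.isZmodule.Build quot_mod
  quot_addA quot_addC quot_add0 quot_addN.

Lemma quot_classD x y : quot_class x + quot_class y = quot_class (x + y).
Proof. exact: quot_addE. Qed.

Lemma quot_scaleA a b p : quot_scale a (quot_scale b p) = quot_scale (a * b) p.
Proof. by elim/quot_ind: p => x; rewrite !quot_scaleE scalerA. Qed.

Lemma quot_scale1 : left_id 1 quot_scale.
Proof. by elim/quot_ind=> x; rewrite quot_scaleE scale1r. Qed.

Lemma quot_scaleDr : right_distributive quot_scale +%R.
Proof.
move=> a; elim/quot_ind=> x; elim/quot_ind=> y.
by rewrite quot_classD !quot_scaleE quot_classD scalerDr.
Qed.

Lemma quot_scaleDl p : {morph quot_scale^~ p : a b / a + b}.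
Proof.
by elim/quot_ind: p => x a b; rewrite !quot_scaleE quot_classD scalerDl.
Qed.

HB.instance Definition _ := GRing.Zmodule_isLmodule.Build K quot_mod
  quot_scaleA quot_scale1 quot_scaleDr quot_scaleDl.

Lemma quot_class_linear : linear quot_class.
Proof. by move=> a x y; rewrite -quot_classD -quot_scaleE. Qed.
HB.instance Definition _ :=
  GRing.isLinear.Build K V quot_mod _ quot_class quot_class_linear.

End QuotientModule.

Section Homology.
Variables (K : pzRingType) (U V W : lmodType K).
Variables (f : {linear U -> V}) (g : {linear V -> W}).

Definition ker_pred : {pred V} := [pred v | g v == 0].

Lemma ker_submod : submod_closed ker_pred.
Proof.
split=> [|a u v]; rewrite !inE ?linear0 // => /eqP gu /eqP gv.
by rewrite linearP gu gv scaler0 addr0.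
Qed.
HB.instance Definition _ := GRing.isSubmodClosed.Build K V ker_pred ker_submod.

Record ker := Ker { ker_val :> V; _ : ker_val \in ker_pred }.
HB.instance Definition _ := [isSub for ker_val].
HB.instance Definition _ := [Choice of ker by <:].
HB.instance Definition _ := [SubChoice_isSubLmodule of ker by <:].

Definition im_pred : {pred ker} := [pred z : ker | `[< exists u, f u = val z >]].

Lemma im_submod : submod_closed im_pred.
Proof.
split=> [|a u v]; rewrite !inE.
  by apply/asboolP; exists 0; rewrite !linear0.
move=> /asboolP[u' eu] /asboolP[v' ev]; apply/asboolP; exists (a *: u' + v').
by rewrite !linearP eu ev.
Qed.
(* In general this is ker g / (im f :&: ker g); for the coboundary maps below
   delta_delta gives the inclusion of im f in ker g. *)
Definition homology : lmodType K := quot_mod (Submodule im_submod).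

End Homology.

Section BoundedCohomology.
Variables (R : realType) (X : rackType).

Definition bcochain_pred n : {pred n.-tuple X -> R^o} :=
  [pred f : n.-tuple X -> R^o | `[< exists M : R, forall x, `|f x| <= M >]].
Arguments bcochain_pred : clear implicits.

Lemma bcochainP n (f : n.-tuple X -> R^o) :
  reflect (exists M : R, forall x, `|f x| <= M) (f \in bcochain_pred n).
Proof. exact: asboolP. Qed.

Lemma bcochain_submod n : submod_closed (bcochain_pred n).
Proof.
split=> [|a f g /bcochainP[M fM] /bcochainP[N gN]]; apply/bcochainP.
  by exists 0 => x; rewrite normr0.
exists (`|a| * M + N) => x; apply: le_trans (ler_normD _ _) _.
by rewrite lerD // normrM ler_wpM2l.
Qed.
HB.instance Definition _ n :=
  GRing.isSubmodClosed.Build R (n.-tuple X -> R^o) (bcochain_pred n) (bcochain_submod n).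

Record bcochain n :=
  BCochain { bcochain_val :> n.-tuple X -> R^o; _ : bcochain_val \in bcochain_pred n }.
HB.instance Definition _ n := [isSub for @bcochain_val n].
HB.instance Definition _ n := [Choice of bcochain n by <:].
HB.instance Definition _ n := [SubChoice_isSubLmodule of bcochain n by <:].

(* (x_1, .., x_(i-1), x_(i+1), .., x_(n+1)) *)
Definition face0 n (i : 'I_n.+1) (x : n.+1.-tuple X) : n.-tuple X :=
  [tuple tnth x (lift i j) | j < n].

(* (x_1 ◁ x_i, .., x_(i-1) ◁ x_i, x_(i+1), .., x_(n+1)) *)
Definition face1 n (i : 'I_n.+1) (x : n.+1.-tuple X) : n.-tuple X :=
  [tuple if (j < i)%N then tnth x (lift i j) ◁ tnth x i else tnth x (lift i j)
  | j < n].

(* The index i of 'I_n.+1 is counted from 0, hence the sign (-1) ^+ i.+1. For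
   n = 0 both faces are the empty tuple, so that delta_fun 0 f = 0. *)
Definition delta_fun n (f : n.-tuple X -> R^o) : n.+1.-tuple X -> R^o :=
  fun x => \sum_(i < n.+1) (-1) ^+ i.+1 * (f (face0 i x) - f (face1 i x)).

Lemma delta_subproof n (f : bcochain n) : delta_fun f \in bcochain_pred n.+1.
Proof.
have [M fM] := bcochainP _ (valP f); apply/bcochainP.
exists (\sum_(i < n.+1) (M + M)) => x; apply: le_trans (ler_norm_sum _ _ _) _.
apply: ler_sum => i _; rewrite normrM normrX normrN1 expr1n mul1r.
by apply: le_trans (ler_normB _ _) _; rewrite lerD ?fM.
Qed.

Definition delta n (f : bcochain n) : bcochain n.+1 := BCochain (delta_subproof f).

Lemma delta_linear n : linear (@delta n).
Proof.
move=> a f g; apply/val_inj/funext => x.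
transitivity (a * delta_fun f x + delta_fun g x); last by [].
rewrite /delta_fun mulr_sumr -big_split; apply: eq_bigr => i _.
set p := face0 i x; set q := face1 i x.
transitivity ((-1) ^+ i.+1 * ((a * f p + g p) - (a * f q + g q))); first by [].
by rewrite opprD addrACA -mulrBr mulrDr mulrCA.
Qed.
HB.instance Definition _ n :=
  GRing.isLinear.Build R (bcochain n) (bcochain n.+1) _ (@delta n) (@delta_linear n).


Lemma delta1E (f : bcochain 1) (x y : X) :
  delta f [tuple x; y] = f [tuple x] - f [tuple x ◁ y].
Proof.
rewrite /= /delta_fun !big_ord_recl big_ord0 /= addr0 expr1 expr2 mulrNN !mulr1.
have -> : face1 ord0 [tuple x; y] = face0 ord0 [tuple x; y].
  by apply: eq_from_tnth => k; rewrite !tnth_mktuple.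
rewrite subrr mulr0 add0r mul1r.
congr (f _ - f _); apply/val_inj; rewrite /= enum_ordSl enum_ord0 /=;
  congr [:: _]; rewrite /tnth //=.
Qed.

Definition face b n (i : 'I_n.+1) (x : n.+1.-tuple X) : n.-tuple X :=
  if b then face1 i x else face0 i x.

Lemma tnth_face b n (i : 'I_n.+1) (x : n.+1.-tuple X) (k : 'I_n) :
  tnth (face b i x) k =
    if b && (k < i)%N then tnth x (lift i k) ◁ tnth x i else tnth x (lift i k).
Proof. by case: b; rewrite /face tnth_mktuple. Qed.


Lemma face_face a b n (i j : 'I_n.+1) (x : n.+2.-tuple X) : (i <= j)%N ->
  face a i (face b (lift ord0 j) x) = face b j (face a (widen_ord (leqnSn _) i) x).
Proof.
move=> ij; apply: eq_from_tnth => k; rewrite !tnth_face /=.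
have -> : lift (lift ord0 j) i = widen_ord (leqnSn _) i.
  by apply/val_inj; rewrite /= /bump; lia.
have -> : lift (widen_ord (leqnSn _) i) j = lift ord0 j.
  by apply/val_inj; rewrite /= /bump; lia.
have -> : lift (lift ord0 j) (lift i k) = lift (widen_ord (leqnSn _) i) (lift j k).
  by apply/val_inj; rewrite /= /bump; lia.
have -> : (bump i k < bump 0 j)%N = (k < j)%N by rewrite /bump; lia.
have -> : (bump j k < i)%N = (k < i)%N by rewrite /bump; lia.
have -> : (i < bump 0 j)%N by rewrite /bump; lia.
have -> : (j < i)%N = false by lia.
rewrite !andbT !andbF.
have kij : (k < i)%N ==> (k < j)%N by apply/implyP => ki; exact: leq_trans ki ij.
clear ij; move: kij.
case: a; case: b => /=; case: (k < i)%N; case: (k < j)%N => //= _.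
exact/esym/rack_opD.
Qed.

Lemma delta_delta n (f : bcochain n) : delta (delta f) = 0.
Proof.
apply/val_inj/funext => x.
pose G (j : 'I_n.+2) (i : 'I_n.+1) : R :=
  f (face false i (face false j x)) - f (face true i (face false j x))
  - (f (face false i (face true j x)) - f (face true i (face true j x))).
pose A (p : 'I_n.+2 * 'I_n.+1) : R := (-1) ^+ (p.1 + p.2) * G p.1 p.2.
have AE j i : A (j, i) = (-1) ^+ (j + i) * G j i by [].
have GE (i j : 'I_n.+1) : (i <= j)%N ->
    G (lift ord0 j) i = G (widen_ord (leqnSn _) i) j.
  by move=> ij; rewrite /G !face_face // !opprB [LHS]addrACA [RHS]addrACA [- _ - _ in LHS]addrC.
transitivity (\sum_p A p).
  rewrite /= /delta_fun -(pair_bigA _ (fun j i => A (j, i))) /=.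
  apply: eq_bigr => j _; rewrite -sumrB mulr_sumr; apply: eq_bigr => i _.
  rewrite -mulrBr mulrA -exprD /A /=.
  by rewrite addSn addnS 2!exprS mulrA mulrNN mulr1 mul1r.
rewrite (bigID (fun p : 'I_n.+2 * 'I_n.+1 => (p.1 <= p.2)%N)) /=.
rewrite [X in _ + X](reindex_onto
  (fun p : 'I_n.+2 * 'I_n.+1 => (lift ord0 p.2, inord p.1 : 'I_n.+1))
  (fun p : 'I_n.+2 * 'I_n.+1 => (widen_ord (leqnSn _) p.2, inord p.1.-1 : 'I_n.+1)));
  last first.
  move=> [j i] /=; rewrite -ltnNge => ij; congr (_, _); apply/val_inj => /=.
    by rewrite inordK /bump; have := ltn_ord j; lia.
  by rewrite inordK.
rewrite [X in _ + X](eq_bigl (fun p : 'I_n.+2 * 'I_n.+1 => (p.1 <= p.2)%N)).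
  rewrite -big_split big1 //= => -[j i] /= ji.
  have jn : (j < n.+1)%N by have := ltn_ord i; lia.
  have jE : widen_ord (leqnSn _) (inord j : 'I_n.+1) = j.
    by apply/val_inj; rewrite /= inordK.
  have ji' : ((inord j : 'I_n.+1) <= i)%N by rewrite inordK.
  rewrite !AE GE // jE lift0 inordK // addSn exprS.
  by rewrite mulN1r mulNr [(i + j)%N]addnC subrr.
move=> [j i] /=.
rewrite -ltnNge [bump _ _]add1n add0n inord_val ltnS -pair_eqE /= eqxx andbT.
rewrite -val_eqE /=; apply/andP/idP => [[le_ji /eqP jE]|le_ji].
  by rewrite -jE.
by rewrite inordK // (leq_trans _ (ltn_ord i)).
Qed.

(* H^n_b(X; R); as C^(-1)_b = 0, the coboundaries of degree 0 are the image of
   a zero map. *)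
Definition Hb n : lmodType R :=
  if n is n'.+1 then homology (@delta n') (@delta n'.+1)
  else homology (\0 : bcochain 0 -> bcochain 0) (@delta 0).

End BoundedCohomology.

(* Main.v *)
(* A function F on a rack X, possibly unbounded, for which F x - F (x ◁ y) is
   bounded has a coboundary that is a bounded 2-cocycle. This cocycle is trivial
   in bounded cohomology only if F is a bounded function plus one that is
   constant on the connected components of X.
   On the free product of the Ad (X s), fix a factor s0 and let rolli k count
   the syllables of degree k minus those of degree -k in the factor s0, where
   the degree Ad (X s) -> Z sends each generator to 1. This is a Rolli
   quasimorphism; it is bounded on the factors, so that (x, g) |-> rolli k g is
   well defined on the free product rack up to a bounded error, and it is
   bounded on the conjugates of the generators, so that it is a function F as
   above. For x in X s0 and y in another factor, on the powers
   (e_x ^ n e_y) ^ m, which move within one connected component, rolli n grows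
   like m and the other rolli k (k > 0) vanish: this gives linear
   independence. *)
Require Import Defs.
From mathcomp Require Import all_boot all_order all_algebra.
From mathcomp Require Import boolp reals zify ring lra.

Set Implicit Arguments.
Unset Strict Implicit.
Unset Printing Implicit Defensive.

Import Order.TTheory GRing.Theory Num.Theory.
Local Open Scope ring_scope.
Local Open Scope rack_scope.

(** * Reduced words in a free product of copies of Z *)

Section Syllables.
Variable I : eqType.
Implicit Types (a : I * int) (u v w : seq (I * int)).

(* Left multiplication of a reduced word by one syllable in the free product of
   copies of Z indexed by I, where (i, n) stands for n in the i-th copy. *)
Definition push a w :=
  if a.2 == 0 then w else
  if w is b :: w' then
    if a.1 == b.1 then
      if a.2 + b.2 == 0 then w' else (a.1, a.2 + b.2) :: w'
    else a :: w
  else [:: a].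

Definition pushes u w := foldr push w u.

Definition reduced w :=
  all (fun a => a.2 != 0) w && sorted (fun i j => i != j) [seq a.1 | a <- w].

Lemma reduced_cons a w :
  reduced (a :: w) =
  [&& a.2 != 0, reduced w & if w is b :: _ then a.1 != b.1 else true].
Proof.
rewrite /reduced; case: w => [|b w] /=; first by rewrite !andbT.
by rewrite -!andbA; do !bool_congr.
Qed.

Lemma reduced_cat u a b v :
  a.1 = b.1 -> reduced (rcons u a) -> reduced (b :: v) -> reduced (u ++ b :: v).
Proof.
rewrite /reduced all_rcons all_cat map_rcons map_cat => ab.
move=> /andP[/andP[_ ->] su] /andP[-> sv]; move: su sv => /=.
rewrite ab; case: [seq a.1 | a <- u] => //= i s.
by rewrite rcons_path cat_path /= => /andP[-> ->].
Qed.

Lemma reduced_rconsl u a : reduced (rcons u a) -> reduced u.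
Proof.
rewrite /reduced all_rcons map_rcons => /andP[/andP[_ ->]] /=.
by case: [seq a.1 | a <- u] => //= i s; rewrite rcons_path => /andP[].
Qed.

Lemma push_reduced a w : reduced w -> reduced (push a w).
Proof.
rewrite /push; case: eqVneq => // a0; case: w => [|b w] /=.
  by rewrite reduced_cons a0.
case: eqVneq => [ab|ab rw]; last by rewrite reduced_cons a0 rw.
case: eqVneq => [_|s0]; first by rewrite reduced_cons => /and3P[].
by rewrite !reduced_cons /= s0 ab => /and3P[_ -> ->].
Qed.

Lemma pushes_reduced u w : reduced w -> reduced (pushes u w).
Proof. by elim: u => //= a u IH /IH; apply: push_reduced. Qed.

Lemma push_cons a w : reduced (a :: w) -> push a w = a :: w.
Proof.
rewrite reduced_cons /push => /and3P[/negPf -> _].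
by case: w => // b w /negPf ->.
Qed.

Lemma pushes_cat u v : reduced (u ++ v) -> pushes u v = u ++ v.
Proof.
elim: u => //= a u IH ruv.
by rewrite IH ?push_cons //; move: ruv; rewrite reduced_cons => /and3P[].
Qed.

(** Van der Waerden's argument: each copy of Z acts on the reduced words, hence so does the free
    product, and normal forms need no confluence proof. *)
Lemma pushD i (m n : int) w :
  reduced w -> push (i, m) (push (i, n) w) = push (i, m + n) w.
Proof.
rewrite /push /=; have [->|n0] := eqVneq n 0; first by rewrite addr0.
have [->|m0] := eqVneq m 0; first by rewrite add0r (negPf n0).
case: w => [_|b w] /=; first by rewrite eqxx.
rewrite reduced_cons => /and3P[b0 rw]; case: (eqVneq i b.1) => [ib bw|ib _].
  have [nb|nb] := eqVneq (n + b.2) 0; last first.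
    rewrite /= eqxx addrA; have [->|//] := eqVneq (m + n) 0.
    by rewrite add0r (negPf b0) ib -surjective_pairing.
  (* Here [n] has cancelled the head [b]. The next syllable has an index other than [i], so [m] goes
     in front of [w] unmerged. *)
  rewrite -addrA nb addr0 (negPf m0).
  have -> : (m + n == 0) = (m == b.2) by apply/eqP/eqP; lia.
  case: eqVneq => [->|mb].
    by rewrite ib; case: w bw {rw} => [|c w] /=; [|move/negPf->]; case: b {b0 nb ib}.
  by case: w bw {rw} => [|c w] //=; rewrite ib => /negPf ->.
by rewrite /= eqxx; case: eqVneq => // _.
Qed.

Lemma pushes_push a u w :
  reduced w -> pushes (push a u) w = push a (pushes u w).
Proof.
move=> rw; rewrite {1}/push; case: eqVneq => [a0|_]; first by rewrite /push a0.
case: u => [//|b u]; case: eqVneq => // ab /=.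
have := pushD a.1 a.2 b.2 (pushes_reduced u rw).
rewrite {2}ab -!surjective_pairing => ->.
by case: eqVneq => // ->; rewrite /push.
Qed.

Lemma pushes_pushes u v w :
  reduced w -> pushes (pushes u v) w = pushes u (pushes v w).
Proof. by move=> rw; elim: u => //= a u IH; rewrite pushes_push // IH. Qed.

(** * The defect of a weight that is odd and bounded by 1 *)

Section Rolli.
Variables (R : realDomainType) (l : I * int -> R).
Hypothesis l_odd : forall i n, l (i, - n) = - l (i, n).
Hypothesis l_le1 : forall a, `|l a| <= 1.

Definition weight w := \sum_(a <- w) l a.

(* As l is odd, the syllables that cancel between u and v contribute nothing;
   at most one pair of syllables is merged. *)
Lemma weight_pushes u v : reduced u -> reduced v ->
  `|weight (pushes u v) - weight u - weight v| <= 3.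
Proof.
rewrite /weight.
(* Cancellation eats [u] from its end and [v] from its start, hence induction on the last syllable
   with [v] general. *)
elim/last_ind: u v => [|u a IH] v.
  by rewrite big_nil subr0 subrr normr0.
move=> rua rv; have ru := reduced_rconsl rua.
have a0 : a.2 != 0 by move: rua; rewrite /reduced all_rcons => /andP[/andP[]].
rewrite /pushes foldr_rcons -/(pushes _ _) -[in \sum_(_ <- rcons _ _) _]cats1 big_cat big_seq1 /=
  [push a v]/push (negPf a0).
case: v rv => [_|b v rbv].
  by rewrite pushes_cat ?cats1 // -cats1 big_cat big_seq1 /= big_nil subr0 subrr normr0.
have [ab|ab] := eqVneq; last first.
  have rauv : reduced (u ++ a :: b :: v).
    by apply: reduced_cat rua _ => //; rewrite reduced_cons a0 rbv.
  rewrite pushes_cat // big_cat /= !big_cons.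
  set x := \sum_(_ <- u) _; set y := \sum_(_ <- v) _.
  by rewrite [X in `|X|](_ : _ = 0) ?normr0 //; ring.
have := rbv; rewrite reduced_cons => /and3P[b0 rv bv].
case: eqVneq => [s0|s0].
  have -> : l a = - l b.
    rewrite [b]surjective_pairing -l_odd -ab [in LHS](surjective_pairing a).
    by congr (l (_, _)); lia.
  rewrite big_cons; have := IH v ru rv.
  set x := \sum_(_ <- pushes _ _) _; set y := \sum_(_ <- u) _; set z := \sum_(_ <- v) _.
  by rewrite [x - (y - l b) - _](_ : _ = x - y - z) //; ring.
have ruv : reduced (u ++ (a.1, a.2 + b.2) :: v).
  by apply: reduced_cat rua _ => //; rewrite reduced_cons /= s0 rv ab.
rewrite pushes_cat // big_cat /= !big_cons.
set x := \sum_(_ <- u) _; set y := \sum_(_ <- v) _; set c := l (_, _).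
(* The merged word is reduced, so the process stops; the 3 counts these three terms of size at most
   1. *)
rewrite [X in `|X|](_ : _ = c - l a - l b); last by ring.
have := l_le1 (a.1, a.2 + b.2); have := l_le1 a; have := l_le1 b; rewrite -/c.
by rewrite !ler_norml; lra.
Qed.

End Rolli.
End Syllables.

(** * Bounded 2-cocycles from unbounded quasi-invariant functions *)

Section QuasiInvariant.
Variables (R : realType) (X : rackType).

Definition cochain1 (F : X -> R) : 1.-tuple X -> R^o := fun x => F (thead x).

Lemma delta_fun1E (F : X -> R) (x : 2.-tuple X) :
  delta_fun (cochain1 F) x
  = F (tnth x ord0) - F (tnth x ord0 ◁ tnth x (lift ord0 ord0)).
Proof.
rewrite /delta_fun /cochain1 !big_ord_recl big_ord0 /thead !tnth_mktuple /=.
rewrite subrr mulr0 add0r addr0 expr2 mulrNN !mul1r.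
by do !congr (_ - _); congr F; do ?congr (_ ◁ _); congr tnth; apply/val_inj.
Qed.

(** [delta_delta] covers bounded cochains only, whereas [F] may be unbounded. *)
Lemma delta_fun2_delta_fun1 (F : X -> R) (x : 3.-tuple X) :
  delta_fun (delta_fun (cochain1 F)) x = 0.
Proof.
(* A default value for [nth], which makes equal entries of [x] syntactically equal. *)
have y : X := tnth x ord0.
rewrite {1}/delta_fun !big_ord_recl big_ord0 !delta_fun1E !tnth_mktuple /=.
rewrite !(tnth_nth y) /bump /=.
rewrite [_ ◁ nth y x 1 ◁ _]rack_opD.
by rewrite !exprS expr0; ring.
Qed.

Variable F : nat -> X -> R.
Hypothesis F_bounded :
  forall i, exists M : R, forall x y, `|F i x - F i (x ◁ y)| <= M.
(** Linear independence modulo bounded functions and functions constant on connected components. *)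
Hypothesis F_free : forall n (c : 'I_n -> R) (h : X -> R) (M : R),
  (forall x, `|h x| <= M) ->
  (forall x y, \sum_i c i * F i x - h x = \sum_i c i * F i (x ◁ y) - h (x ◁ y)) ->
  forall i, c i = 0.

Lemma qinv_subproof i : delta_fun (cochain1 (F i)) \in @bcochain_pred R X 2.
Proof.
by have [M FM] := F_bounded i; apply/bcochainP; exists M => x; rewrite delta_fun1E.
Qed.

Definition qinv_cochain i : bcochain R X 2 := BCochain (qinv_subproof i).

Lemma qinv_cocycle_subproof i : qinv_cochain i \in ker_pred (@delta R X 2).
Proof. by apply/eqP/val_inj/funext => x; apply: delta_fun2_delta_fun1. Qed.

Definition qinv_cocycle i : ker (@delta R X 2) := Ker (qinv_cocycle_subproof i).

(** Among [n.+1] classes in the span of [n] vectors there is a relation [d]. It yields a bounded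
    primitive [h] of a combination of the cocycles, against [F_free]. *)
Lemma Hb2_not_fin_dim : ~ fin_dim (Hb R X 2).
Proof.
move=> [n [v v_span]].
pose W := Submodule (im_submod (@delta R X 1) (@delta R X 2)).
pose q i : Hb R X 2 := quot_class W (qinv_cocycle i).
have [C qC] : exists C : 'M[R]_(n.+1, n), forall i : 'I_n.+1, q i = \sum_j C i j *: v j.
  have [c cE] := choice (fun i : 'I_n.+1 => v_span (q i)).
  by exists (\matrix_(i, j) c i j) => i; rewrite cE; apply: eq_bigr => j _; rewrite mxE.
have /rowV0Pn[d /sub_kermxP dC d0] : kermx C != 0.
  by rewrite kermx_eq0 /row_free neq_ltn (leq_ltn_trans (rank_leq_col _)).
have dq : \sum_i d 0 i *: q i = 0.
  transitivity (\sum_j (d *m C) 0 j *: v j).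
    under eq_bigr => i _ do rewrite qC scaler_sumr.
    rewrite exchange_big; apply: eq_bigr => j _; rewrite mxE scaler_suml.
    by apply: eq_bigr => i _; rewrite scalerA.
  by rewrite dC big1 // => j _; rewrite mxE scale0r.
pose z := \sum_i d 0 i *: qinv_cocycle i.
have : quot_class W z = quot_class W 0.
  rewrite linear0 -dq linear_sum; apply: eq_bigr => i _; exact: linearZ.
move=> /quot_classP; rewrite subr0 => /asboolP[h hE].
have [M hM] := bcochainP _ (valP h).
case/eqP: d0; apply/rowP => i; rewrite mxE.
apply: (F_free (c := fun i => d 0 i) (h := fun x => h [tuple x]) (M := M)) =>
  [x|x y]; first exact: hM.
have := congr1 (fun f : bcochain R X 2 => f [tuple x; y]) hE.
rewrite delta1E.
have zE r : val (val (\sum_(j <- r) d 0 j *: qinv_cocycle j)) [tuple x; y]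
    = \sum_(j <- r) d 0 j * (F j x - F j (x ◁ y)).
  elim: r => [|j r IH]; first by rewrite !big_nil !linear0.
  rewrite !big_cons -IH -[F j x - _](delta_fun1E (F j) [tuple x; y]).
  by rewrite linearP.
rewrite [X in _ = X -> _](zE _).
under eq_bigr do rewrite mulrBr.
rewrite sumrB => E; apply/eqP; rewrite subr_eq addrAC -addrA E.
by rewrite addrC subrK.
Qed.

End QuasiInvariant.

(** * The degree homomorphism of the adjoint group *)

Section Degree.
Variable X : rackType.

Definition word_degree (u : seq (X * bool)) : int := \sum_(a <- u) (-1) ^+ a.2.

Lemma word_degree_eq u v : pres_eq (@ad_rel X) u v -> word_degree u = word_degree v.
Proof.
rewrite /word_degree; elim=> {u v} //.
- by move=> _ _ [x y]; rewrite !big_cons !big_nil.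
- by move=> x b; rewrite !big_cons big_nil; case: b.
- by move=> u u' v v' _ IHu _ IHv; rewrite !big_cat /= IHu IHv.
- by move=> u v w _ -> _ ->.
Qed.

Definition ad_degree (g : Ad X) : int := word_degree (repr g).

Lemma ad_degree_class u : ad_degree (pres_class (@ad_rel X) u) = word_degree u.
Proof. exact/word_degree_eq/repr_pres. Qed.

Lemma ad_degreeM g h : ad_degree (g * h)%g = ad_degree g + ad_degree h.
Proof.
rewrite -(pres_class_repr g) -(pres_class_repr h) -pres_class_cat.
by rewrite !ad_degree_class /word_degree big_cat.
Qed.

Lemma ad_degree_gen x : ad_degree (ad_gen x) = 1.
Proof. by rewrite ad_degree_class /word_degree big_seq1. Qed.

Lemma ad_degree1 : ad_degree 1%g = 0.
Proof. by rewrite [1%g]/(pres_class _ [::]) ad_degree_class /word_degree big_nil. Qed.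

Lemma ad_degree_expg x n : ad_degree (ad_gen x ^+ n)%g = n%:Z.
Proof.
elim: n => [|n IH]; first exact: ad_degree1.
by rewrite expgS ad_degreeM IH ad_degree_gen; lia.
Qed.

End Degree.

(** * Rolli quasimorphisms on the free product of adjoint groups *)

Section FreeProductQuasimorphism.
Variables (S : choiceType) (X : S -> rackType).
Local Notation AdX := (fun s => Ad (X s)).
Local Notation FAd := (free_prod AdX).
Local Notation ad_in t := (@free_prod_in S AdX t).
Local Notation word := (seq ({s : S & Ad (X s)} * bool)).

(** The degrees of the factors together map the free product of the [Ad (X s)] to that of copies of
    Z. *)
Definition syllable (a : {s : S & Ad (X s)} * bool) : S * int :=
  (tag a.1, (-1) ^+ a.2 * ad_degree (tagged a.1)).

Definition syllables (u : word) := [seq syllable a | a <- u].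

Lemma pushes_syllables_eq (u v : word) w :
  pres_eq (@fprod_rel S AdX) u v -> reduced w ->
  pushes (syllables u) w = pushes (syllables v) w.
Proof.
move=> uv; elim: uv w => {u v} //.
- move=> _ _ [s g h] w rw; rewrite /= pushD //.
  by rewrite /syllable /= !mul1r ad_degreeM.
- move=> [s g] b w rw; rewrite /= pushD // -mulrDl /push /=.
  by case: b => /=; rewrite ?subrr ?addNr mul0r.
- move=> u u' v v' _ IHu _ IHv w rw.
  rewrite /syllables !map_cat /pushes !foldr_cat -!/(pushes _ _).
  by rewrite [pushes _ w]IHv // IHu // pushes_reduced.
- by move=> u v _ IH w rw; rewrite IH.
- by move=> u v u' _ IH1 _ IH2 w rw; rewrite IH1 // IH2.
Qed.

Definition normal_form (g : FAd) := pushes (syllables (repr g)) [::].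

Lemma normal_form_class u :
  normal_form (pres_class _ u) = pushes (syllables u) [::].
Proof. exact/pushes_syllables_eq/erefl/repr_pres. Qed.

Lemma normal_form_reduced g : reduced (normal_form g).
Proof. exact: pushes_reduced. Qed.

Lemma normal_form_in s (g : Ad (X s)) :
  normal_form (ad_in s g) = push (s, ad_degree g) [::].
Proof. by rewrite normal_form_class /= /syllable /= mul1r. Qed.

Lemma normal_formM g h :
  normal_form (g * h)%g = pushes (normal_form g) (normal_form h).
Proof.
rewrite pushes_pushes ?pushes_reduced //= -{1}(pres_class_repr g).
rewrite -{1}(pres_class_repr h) -pres_class_cat normal_form_class.
by rewrite /syllables map_cat /pushes foldr_cat.
Qed.

Lemma normal_form1 : normal_form 1%g = [::].
Proof. exact: (normal_form_class [::]). Qed.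

(** As [n.+1] is nonzero and [s != t], the alternating word is already reduced. *)
Lemma normal_form_alternating s t (x : X s) (y : X t) n m : s != t ->
  normal_form ((ad_in s (ad_gen x ^+ n.+1) * ad_in t (ad_gen y)) ^+ m)%g
  = flatten (nseq m [:: (s, n.+1%:Z); (t, 1)]).
Proof.
move=> st; pose w k := flatten (nseq k [:: (s, n.+1%:Z); (t, 1 : int)]).
have rw k : reduced (w k).
  elim: k => //= k IH; rewrite !reduced_cons /= IH st.
  by case: k {IH} => //= k; rewrite eq_sym st.
elim: m => [|m IH]; first exact: normal_form1.
rewrite expgS !normal_formM IH !normal_form_in ad_degree_expg ad_degree_gen.
have -> : pushes (push (s, n.+1%:Z) [::]) (push (t, 1) [::]) = w 1%N.
  by rewrite -[RHS](pushes_cat (rw 1%N)).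
by rewrite pushes_cat //; apply: (rw m.+1).
Qed.


Variable (R : realDomainType) (s0 : S).

(** For [k = 0] the two terms cancel, hence the index [k.+1] in the independent family below. *)
Definition count_syllable (k : nat) (a : S * int) : R :=
  (a == (s0, k%:Z))%:R - (a == (s0, - k%:Z))%:R.

Definition rolli k (g : FAd) : R := weight (count_syllable k) (normal_form g).

Lemma count_syllable_odd k i n : count_syllable k (i, - n) = - count_syllable k (i, n).
Proof. by rewrite /count_syllable opprB !xpair_eqE eqr_opp eqr_oppLR. Qed.

Lemma count_syllable_le1 k a : `|count_syllable k a| <= 1.
Proof.
rewrite /count_syllable; case: eqP; case: eqP => _ _;
  by rewrite ?subr0 ?sub0r ?subrr ?normrN ?normr1 ?normr0.
Qed.

Lemma rolliM k g h : `|rolli k (g * h)%g - rolli k g - rolli k h| <= 3.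
Proof.
rewrite /rolli normal_formM; apply: weight_pushes.
- exact: count_syllable_odd.
- exact: count_syllable_le1.
- exact: normal_form_reduced.
- exact: normal_form_reduced.
Qed.

Lemma rolli1 k : rolli k 1%g = 0.
Proof. by rewrite /rolli normal_form1 /weight big_nil. Qed.

Lemma rolli_in k s (g : Ad (X s)) : `|rolli k (ad_in s g)| <= 1.
Proof.
rewrite /rolli normal_form_in /push /weight /=; case: ifP => _.
  by rewrite big_nil normr0.
by rewrite big_seq1 count_syllable_le1.
Qed.

(** The 9 is three defects of 3; the one for [h^-1 * h = 1] bounds the sum of the values at [h^-1]
    and [h]. *)
Lemma rolli_conj k g h :
  `|rolli k (h^-1 * g * h)%g| <= `|rolli k g| + 9.
Proof.
have := rolliM k (h^-1 * g)%g h; have := rolliM k (h^-1)%g g.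
have := rolliM k (h^-1)%g h; rewrite mulVg rolli1 !ler_norml.
move: (rolli k g) (rolli k h) (rolli k _) (rolli k _) (rolli k _) => a b c d e.
have := ler_norm a; have := ler_norm (- a); rewrite normrN.
by lra.
Qed.

End FreeProductQuasimorphism.

(** * Descent to the free product rack and linear independence *)

Section FreeProductRackQuasiInvariant.
Variables (R : realType) (S : choiceType) (X : S -> rackType).
Local Notation AdX := (fun s => Ad (X s)).
Local Notation FAd := (free_prod AdX).
Local Notation ad_in t := (@free_prod_in S AdX t).
Local Notation pre_rack := ({t : S & X t} * FAd)%type.
Implicit Types (p q : pre_rack) (g : FAd) (x y : free_rack_prod X).

(** The index [t] is constant along a chain of steps, so their left factors multiply within one
    [Ad (X t)]. Thus the error for [rolli] does not grow with the chain. *)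
Lemma frack_eq_coset p q : frack_eq p q ->
  exists t (g : Ad (X t)), [/\ tag p.1 = t, tag q.1 = t & p.2 = (ad_in t g * q.2)%g].
Proof.
elim=> [_ _ [t x g w] | r | r s _ [t [g [rt st rs]]] |].
- by exists t, g.
- by exists (tag r.1), 1%g; split; rewrite // free_prod_in1 mul1g.
- by exists t, g^-1%g; split; rewrite // rs free_prod_inV mulKg.
move=> r s u _ [t [g [rt st rs]]] _ [t' [g' [st' ut su]]].
have tt' : t' = t by rewrite -st -st'.
move: g' ut su; rewrite tt' => g' ut su.
by exists t, (g * g')%g; split; rewrite // rs su free_prod_inM mulgA.
Qed.

Variable s0 : S.
Local Notation phi := (@rolli S X R s0).

(* Another representative of x changes this by at most 4 (rolli_rack_class). *)
Definition rolli_rack k (x : free_rack_prod X) : R := phi k (repr x).2.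

Lemma rolli_rack_class k p : `|rolli_rack k (frack_class p) - phi k p.2| <= 4.
Proof.
have /frack_eq_coset [t [g [_ _ pE]]] : frack_eq (repr (frack_class p)) p.
  by apply/frack_classP; rewrite frack_class_repr.
rewrite /rolli_rack pE; have := rolliM R s0 k (ad_in t g) p.2.
by have := rolli_in R s0 k g; rewrite !ler_norml; lra.
Qed.

(** 17 = 4 + 3 + 9 + 1: change of representative, product, conjugation, value at a generator. *)
Lemma rolli_rack_quasi_invariant k x y :
  `|rolli_rack k x - rolli_rack k (x ◁ y)| <= 17.
Proof.
rewrite -{2}(frack_class_repr x) -(frack_class_repr y) frack_class_op.
have := rolli_rack_class k (pre_op (repr x) (repr y)); rewrite /=.
set a := rolli_rack k (frack_class _).
have := rolliM R s0 k (repr x).2 ((repr y).2^-1 * fad_gen (repr y).1 * (repr y).2)%g.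
have := rolli_conj R s0 k (fad_gen (repr y).1) (repr y).2.
have := rolli_in R s0 k (ad_gen (tagged (repr y).1)).
rewrite -/(fad_gen _) -/(rolli_rack k x).
set b := phi k ((repr y).2^-1 * _ * _)%g; set c := phi k ((repr x).2 * _)%g.
move: a b c `|phi k (fad_gen _)| => a b c d.
by rewrite !ler_norml; lra.
Qed.

(** Right multiplication by a generator [e_z] is the rack operation by the class of [(z, 1)]. *)
Lemma rack_invariant_mulr (T : Type) (f : free_rack_prod X -> T) :
  (forall x y, f x = f (x ◁ y)) ->
  forall s (x : X s) t (y : X t) k m p,
  f (frack_class (p.1, p.2 * (ad_in s (ad_gen x ^+ k) * ad_in t (ad_gen y)) ^+ m)%g)
  = f (frack_class p).
Proof.
move=> f_inv s x t y k m.
pose stable g := forall p, f (frack_class (p.1, p.2 * g)%g) = f (frack_class p).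
have stable_gen u (z : X u) : stable (ad_in u (ad_gen z)).
  move=> p; rewrite [RHS](f_inv _ (frack_class (Tagged X z, 1%g))) frack_class_op.
  by rewrite /pre_op /= invg1 mul1g mulg1.
have stableM g h : stable g -> stable h -> stable (g * h)%g.
  by move=> sg sh p; rewrite mulgA (sh (p.1, p.2 * g)%g) sg.
have stable1 : stable 1%g by move=> p; rewrite mulg1 -surjective_pairing.
suff stable_xk : stable (ad_in s (ad_gen x ^+ k)).
  elim: m => [|m IH]; first exact: stable1.
  by rewrite expgS; apply: (stableM) IH; apply: (stableM).
elim: k => [|k IH]; first by rewrite free_prod_in1.
by rewrite expgS free_prod_inM; apply: stableM.
Qed.

Lemma rolli_alternating t (x : X s0) (y : X t) (k n m : nat) : s0 != t ->
  phi k.+1 ((ad_in s0 (ad_gen x ^+ n.+1) * ad_in t (ad_gen y)) ^+ m)%g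
  = (k == n)%:R * m%:R.
Proof.
move=> st; rewrite /rolli normal_form_alternating // /weight.
elim: m => [|m IH]; first by rewrite big_nil mulr0.
rewrite /= !big_cons IH /count_syllable !xpair_eqE eqxx [t == s0]eq_sym (negPf st) /=.
rewrite subrr add0r subr0 eqz_nat eqSS [n == k]eq_sym.
by rewrite -natr1 mulrDr mulr1 addrC.
Qed.

Lemma rolli_rack_free t (x : X s0) (y : X t) : s0 != t ->
  forall n (c : 'I_n -> R) (h : free_rack_prod X -> R) (M : R),
  (forall z, `|h z| <= M) ->
  (forall z w, \sum_i c i * rolli_rack i.+1 z - h z
    = \sum_i c i * rolli_rack i.+1 (z ◁ w) - h (z ◁ w)) ->
  forall i, c i = 0.
Proof.
move=> st n c h M hM f_inv i.
pose p0 : pre_rack := (Tagged X y, 1%g).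
pose f z := \sum_i c i * rolli_rack i.+1 z - h z.
(* The terms bound the change of representatives, the constant value of [f] along the powers, and
   [h]; none depends on [m]. *)
pose B := \sum_j `|c j| * 4 + `|f (frack_class p0)| + M.
have cB m : `|c i| * m%:R <= B.
  pose g := ((ad_in s0 (ad_gen x ^+ i.+1) * ad_in t (ad_gen y)) ^+ m)%g.
  pose z := frack_class (p0.1, p0.2 * g)%g.
  have fz : f z = f (frack_class p0) by apply: rack_invariant_mulr.
  have -> : `|c i| * m%:R = `|\sum_j c j * phi j.+1 g|.
    rewrite (bigD1 i) //= big1 => [|j ji]; rewrite rolli_alternating //.
      by rewrite eqxx mul1r addr0 normrM normr_nat.
    by rewrite val_eqE (negPf ji) mul0r mulr0.
  have -> : \sum_j c j * phi j.+1 g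
      = \sum_j c j * (phi j.+1 g - rolli_rack j.+1 z) + f z + h z.
    rewrite /f addrA subrK -big_split; apply: eq_bigr => j _.
    by rewrite /= -mulrDr subrK.
  rewrite fz; apply: le_trans (ler_normD _ _) _; apply: lerD (hM _).
  apply: le_trans (ler_normD _ _) _; apply: lerD => //.
  apply: le_trans (ler_norm_sum _ _ _) _; apply: ler_sum => j _.
  rewrite normrM ler_wpM2l // distrC -[g]mul1g.
  exact: (rolli_rack_class j.+1 (p0.1, p0.2 * g)%g).
apply/eqP/negPn/negP => ci0; have ci : 0 < `|c i| by rewrite normr_gt0.
(* The Archimedean property now gives an [m] that violates [cB]. *)
have B0 : 0 <= B / `|c i|.
  by rewrite divr_ge0 //; have := cB 0%N; rewrite mulr0.
by have := archi_boundP B0; rewrite ltr_pdivrMr // mulrC ltNge cB.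
Qed.

End FreeProductRackQuasiInvariant.

Theorem theorem1p1 (R : realType) (S : finType) (X : S -> rackType)
    (S_ge2 : (2 <= #|S|)%N)
    (X_nonempty : forall s, inhabited (X s))
    (X_fg : forall s, rack_fg (X s)) :
  ~ fin_dim (Hb R (free_rack_prod X) 2).
Proof.
have /card_gt1P[s [t [_ _ st]]] := S_ge2.
have [x] := X_nonempty s; have [y] := X_nonempty t.
apply: (Hb2_not_fin_dim (F := fun k => rolli_rack R s k.+1)).
- by move=> k; exists 17 => z w; apply: rolli_rack_quasi_invariant.
- exact: rolli_rack_free x y st.
Qed.
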